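(* Let $\mathbb{F}$ be a field of characteristic different from two and let $(\mathcal{P},\circ,\{\cdot,\cdot\})$ be a transposed Poisson algebra over $\mathbb{F}$. Then the Kantor double $\mathfrak{J}(\mathcal{P})$ is a Jordan superalgebra. Moreover, if the Lie bracket of $\mathcal{P}$ is not identically zero, then $\mathfrak{J}(\mathcal{P})$ is simple if and only if $\mathcal{P}$ is simple and $\mathcal{P}\circ\mathcal{P}=\mathcal{P}$.
   Context: A transposed Poisson algebra is a vector space $\mathcal{P}$ (of arbitrary dimension) with an associative commutative multiplication $\circ$ (not necessarily unital) and a Lie bracket $\{\cdot,\cdot\}$ such that $2x\circ\{y,z\}=\{x\circ y,z\}+\{y,x\circ z\}$ for all $x,y,z\in\mathcal{P}$. An ideal is a proper nonzero subspace $\mathcal{I}$ with $\mathcal{I}\circ\mathcal{P}\subset\mathcal{I}$ and $\{\mathcal{I},\mathcal{P}\}\subset\mathcal{I}$; $\mathcal{P}$ is simple if it contains no ideals. $\mathcal{P}\circ\mathcal{P}$ is the linear span of all products $a\circ b$. Kantor double: let $\mathcal{P}^s=\{a^s: a\in\mathcal{P}\}$ be a copy of the vector space $\mathcal{P}$. $\mathfrak{J}(\mathcal{P})=\mathcal{P}\oplus\mathcal{P}^s$ is the superalgebra with even part $\mathcal{P}$, odd part $\mathcal{P}^s$ and bilinear multiplication $a*b=a\circ b$, $a^s*b=a*b^s=(a\circ b)^s$, $a^s*b^s=\{a,b\}$ for $a,b\in\mathcal{P}$. A Jordan superalgebra is a superalgebra $\mathcal{J}=\mathcal{J}_0\oplus\mathcal{J}_1$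 with product $\cdot$ such that, for all homogeneous $x,y,z$, $x\cdot y=(-1)^{|x||y|}y\cdot x$ and $(-1)^{|x||z|}[L_{x\cdot y},L_z]+(-1)^{|y||x|}[L_{y\cdot z},L_x]+(-1)^{|z||y|}[L_{z\cdot x},L_y]=0$, where $L_x$ is left multiplication by $x$ and $[L_x,L_y]=L_xL_y-(-1)^{|x||y|}L_yL_x$. A superalgebra is simple if it contains no proper nonzero $\mathbb{Z}_2$-graded ideals. *)

(* Defs.v *)
From HB Require Import structures.
From mathcomp Require Import all_boot all_algebra.
From mathcomp Require Import boolp classical_sets.

Set Implicit Arguments.
Unset Strict Implicit.
Unset Printing Implicit Defensive.

Import GRing.Theory.

Local Open Scope classical_set_scope.
Local Open Scope ring_scope.

(* Vector spaces have arbitrary dimension, so their subspaces are Prop-valued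
   sets rather than the detachable subspaces {vspace _}. *)
Definition is_subspace (F : fieldType) (V : lmodType F) (S : set V) : Prop :=
  submod_closed [in S].

Definition linear_span (F : fieldType) (V : lmodType F) (A : set V) : set V :=
  [set v | exists (n : nat) (c : 'I_n -> F) (a : 'I_n -> V),
    (forall i, A (a i)) /\ v = \sum_(i < n) c i *: a i].

Section TransposedPoisson.
Variables (F : fieldType) (P : lmodType F).
Implicit Types mul br : {bilinear P -> P -> P}.

Record is_lie_bracket br : Prop := IsLieBracket {
  lie_alternating : forall x, br x x = 0;
  lie_jacobi : forall x y z,
    br x (br y z) + br y (br z x) + br z (br x y) = 0 }.

Record is_transposed_poisson mul br : Prop := IsTransposedPoisson {
  tp_mulA : associative mul;
  tp_mulC : commutative mul;
  tp_lie : is_lie_bracket br;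
  tp_compat : forall x y z,
    2%:R *: mul x (br y z) = br (mul x y) z + br y (mul x z) }.

Record is_tp_ideal mul br (I : set P) : Prop := IsTpIdeal {
  tp_ideal_subspace : is_subspace I;
  tp_ideal_nonzero : I <> [set 0];
  tp_ideal_proper : I <> setT;
  tp_ideal_mul : forall x y, I x -> I (mul x y);
  tp_ideal_br : forall x y, I x -> I (br x y) }.

Definition tp_simple mul br : Prop := ~ exists I : set P, is_tp_ideal mul br I.

Definition product_span mul : set P :=
  linear_span [set mul a b | a in setT & b in setT].

End TransposedPoisson.

Section Superalgebra.
Variables (F : fieldType) (J : lmodType F).
Implicit Types (G : bool -> set J) (m : {bilinear J -> J -> J}) (f g : J -> J).

(* G false is the even part of J and G true its odd part. The parity of a
   homogeneous element is passed explicitly, as a boolean i with G i x; 0 is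
   homogeneous of both parities. *)
Record is_superalgebra G m : Prop := IsSuperalgebra {
  sa_subspace : forall i, is_subspace (G i);
  sa_sum : forall x, exists x0 x1, [/\ G false x0, G true x1 & x = x0 + x1];
  sa_direct : G false `&` G true = [set 0];
  sa_mul : forall i j x y, G i x -> G j y -> G (i (+) j) (m x y) }.

Definition supersign (i j : bool) : F := (-1) ^+ (i && j).

(* [f, g] for operators f of parity i and g of parity j *)
Definition supercomm (i j : bool) f g : J -> J :=
  fun v => f (g v) - supersign i j *: g (f v).

Record is_jordan_superalgebra G m : Prop := IsJordanSuperalgebra {
  js_superalgebra : is_superalgebra G m;
  js_supercomm : forall i j x y, G i x -> G j y ->
    m x y = supersign i j *: m y x;
  js_jordan : forall i j k x y z, G i x -> G j y -> G k z -> forall v,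
      supersign i k *: supercomm (i (+) j) k (m (m x y)) (m z) v
    + supersign j i *: supercomm (j (+) k) i (m (m y z)) (m x) v
    + supersign k j *: supercomm (k (+) i) j (m (m z x)) (m y) v = 0 }.

Record is_graded_ideal G m (I : set J) : Prop := IsGradedIdeal {
  gi_subspace : is_subspace I;
  gi_left : forall x y, I y -> I (m x y);
  gi_right : forall x y, I x -> I (m x y);
  gi_graded : forall x, I x -> exists x0 x1,
    [/\ G false x0 /\ I x0, G true x1 /\ I x1 & x = x0 + x1] }.

Definition sa_simple G m : Prop :=
  ~ exists I : set J, [/\ is_graded_ideal G m I, I <> [set 0] & I <> setT].

End Superalgebra.

Section KantorDouble.
Variables (F : fieldType) (P : lmodType F).
Variables (mul br : {bilinear P -> P -> P}).

(* The pair (a, b) stands for a + b^s. *)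
Definition kantor_double : lmodType F := (P * P)%type.

Definition kantor_part (i : bool) : set kantor_double :=
  if i then [set u | u.1 = 0] else [set u | u.2 = 0].

(* Bilinear extension of a * c = a o c, a * d^s = (a o d)^s,
   b^s * c = (b o c)^s and b^s * d^s = {b, d}. *)
Definition kantor_mul (u v : kantor_double) : kantor_double :=
  (mul u.1 v.1 + br u.2 v.2, mul u.2 v.1 + mul u.1 v.2).

Lemma kantor_mul_bilinear : bilinear_for *:%R *:%R kantor_mul.
Proof.
split=> w a u v; congr pair; rewrite /= ?(linearPl, linearPr) scalerDr.
- by rewrite addrACA.
- by rewrite addrACA.
- by rewrite addrACA.
- by rewrite addrACA.
Qed.

HB.instance Definition _ :=
  bilinear_isBilinear.Build F kantor_double kantor_double kantor_double
    *:%R *:%R kantor_mul kantor_mul_bilinear.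

End KantorDouble.

Arguments kantor_part {F} P i.

(* Main.v *)
Require Import Defs.
From HB Require Import structures.
From mathcomp Require Import all_boot all_algebra.
From mathcomp Require Import boolp classical_sets.

(** Jordan identity. Summing the compatibility axiom cyclically, in characteristic
    not two, and expanding 4 (x o y) o {z, d} with it in two different ways give
    the identities mul_br_cyclic and br_exchange:
    - x o {y, z} + y o {z, x} + z o {x, y} = 0,
    - {x o y o z, d} + {z, x o y o d} = {y o z, x o d} + {x o z, y o d}.
    Together with the Jacobi identity they also yield that
    {z, d o {x, y}} and {x, y} o {z, d} have zero sum over the cyclic
    permutations of x, y, z (br_mul_br_cyclic, mul_br_br_cyclic). The Jordan
    superidentity is invariant under cyclic permutation of its three arguments,
    so only the parities even-even-even, even-even-odd, even-odd-odd and
    odd-odd-odd matter; in each of them it reduces, component by component, to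
    one of these four identities or to commutativity and associativity.

    Simplicity. If I is an ideal of P then I + I^s is a graded ideal of the
    double, and the double also has the graded ideal P + (P o P)^s; so
    simplicity of the double forces P to be simple and P o P = P. Conversely a
    graded ideal of the double is I0 + I1^s where I0 o P and I1 o P lie in I1 and
    {I1, P} lies in I0. Neither I0 nor I1 need be an ideal of P, but
    R = {r | r o P is contained in I1}, which contains both, is one: it is
    obviously stable under multiplication, and
      (x o w) o {e, y} = w o {x o e, y} - e o {x o y, w} + e o (x o {y, w})
    together with P o P = P makes it stable under the bracket (multiplier_br).
    If R = 0 the graded ideal is zero. If R = P then P = P o P lies in I1, and
    since {P, P} spans P (bracket_span_full) it lies in I0 as well, so the
    graded ideal is the whole double. *)

Import GRing.Theory.

Local Open Scope classical_set_scope.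
Local Open Scope ring_scope.

(** * Prop-valued subspaces and linear spans *)

Section Subspaces.
Context {F : fieldType} {V : lmodType F}.
Implicit Types (S A : set V).

Lemma subspaceP S :
  is_subspace S <-> S 0 /\ forall c u v, S u -> S v -> S (c *: u + v).
Proof.
rewrite /is_subspace; split=> -[S0 Slin]; split.
- by rewrite inE in S0.
- by move=> c u v Su Sv; have := Slin c u v; rewrite !inE; apply.
- by rewrite inE.
- by move=> c u v; rewrite !inE; apply: Slin.
Qed.

Lemma subspace0 S : is_subspace S -> S 0.
Proof. by case/subspaceP. Qed.

Lemma subspaceZ S c u : is_subspace S -> S u -> S (c *: u).
Proof. by case/subspaceP=> S0 Slin Su; rewrite -[_ *: _]addr0; apply: Slin. Qed.

Lemma subspaceD S u v : is_subspace S -> S u -> S v -> S (u + v).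
Proof. by case/subspaceP=> S0 Slin Su Sv; rewrite -[u]scale1r; apply: Slin. Qed.

Lemma subspaceN S u : is_subspace S -> S u -> S (- u).
Proof. by move=> Ssub Su; rewrite -scaleN1r; apply: subspaceZ. Qed.

Lemma subspaceB S u v : is_subspace S -> S u -> S v -> S (u - v).
Proof. by move=> Ssub Su Sv; apply: subspaceD => //; apply: subspaceN. Qed.

Lemma span_sub A S : is_subspace S -> A `<=` S -> linear_span A `<=` S.
Proof.
move=> Ssub AS _ [n [c [a [Aa ->]]]].
elim/big_ind: _ => [|u v Su Sv|i _].
- exact: subspace0.
- exact: subspaceD.
- by apply: subspaceZ => //; apply: AS.
Qed.

Lemma mem_span A : A `<=` linear_span A.
Proof.
move=> a Aa; exists 1, (fun=> 1), (fun=> a); split=> //.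
by rewrite big_ord1 scale1r.
Qed.

Lemma span_subspace A : is_subspace (linear_span A).
Proof.
apply/subspaceP; split.
  by exists 0, (fun=> 0), (fun=> 0); split=> [[]|] //; rewrite big_ord0.
move=> k _ _ [m [c [a [Aa ->]]]] [n [d [b [Ab ->]]]].
pose glue T (f : 'I_m -> T) (g : 'I_n -> T) i :=
  match split i with inl j => f j | inr j => g j end.
exists (m + n)%N, (glue F (fun j => k * c j) d), (glue V a b); split.
  by move=> i; rewrite /glue; case: split.
rewrite big_split_ord scaler_sumr /=; congr (_ + _); apply: eq_bigr => j _.
  by rewrite /glue -[lshift n j]/(unsplit (inl j)) unsplitK scalerA.
by rewrite /glue -[rshift m j]/(unsplit (inr j)) unsplitK.
Qed.

Lemma subspace_preiml S (f : {bilinear V -> V -> V}) y :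
  is_subspace S -> is_subspace [set x | S (f x y)].
Proof.
case/subspaceP=> S0 Slin; apply/subspaceP; split=> [|c u v Su Sv] /=.
  by rewrite linear0l.
by rewrite linearPl; apply: Slin.
Qed.

End Subspaces.

(** * Identities of transposed Poisson algebras *)

Section Identities.
Context {F : fieldType} {P : lmodType F} {mul br : {bilinear P -> P -> P}}.
Hypotheses (char_neq2 : 2%N \notin [pchar F])
           (tpP : is_transposed_poisson mul br).

Local Notation "x ** y" := (mul x y) (at level 40, left associativity).
Local Notation "{[ x , y ]}" := (br x y) (at level 0, format "{[ x ,  y ]}").

Lemma two_neq0 : 2%:R != 0 :> F.
Proof. by move: char_neq2; rewrite inE /=. Qed.

Lemma double_inj (u v : P) : u + u = v + v -> u = v.
Proof.
rewrite -![_ + _]mulr2n -!scaler_nat.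
exact: (scalerI two_neq0).
Qed.

Lemma tp_mulCA x y z : x ** (y ** z) = y ** (x ** z).
Proof. by rewrite !(tp_mulA tpP) [x ** y](tp_mulC tpP). Qed.

Lemma tp_mulAC x y z : x ** y ** z = x ** z ** y.
Proof. by rewrite -!(tp_mulA tpP) [y ** z](tp_mulC tpP). Qed.

Lemma brC x y : {[x, y]} = - {[y, x]}.
Proof.
apply/eqP; rewrite -addr_eq0; apply/eqP.
have alt := lie_alternating (tp_lie tpP).
by have := alt (x + y); rewrite linearDl !linearDr !alt add0r addr0.
Qed.

Lemma mul_br_double x y z :
  x ** {[y, z]} + x ** {[y, z]} = {[x ** y, z]} + {[y, x ** z]}.
Proof. by rewrite -(tp_compat tpP) scaler_nat mulr2n. Qed.

(** The terms {x o y, z} arising from the three compatibility axioms cancel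
    pairwise by skew-symmetry, so that twice the sum is zero. *)
Lemma mul_br_cyclic x y z :
  x ** {[y, z]} + y ** {[z, x]} + z ** {[x, y]} = 0.
Proof.
apply: double_inj; rewrite addr0 addrACA [X in X + _]addrACA !mul_br_double.
rewrite [br y _]brC [br z (y ** x)]brC [br x _]brC.
rewrite [y ** x](tp_mulC tpP) [x ** z](tp_mulC tpP) [z ** y](tp_mulC tpP).
by rewrite [X in X + _]addrC !addrA !subrK subrr.
Qed.

(** Expanding 4 (x o y) o {z, d} with x o y as a single factor gives twice the
    left-hand side; expanding it as 4 x o (y o {z, d}), one factor at a time,
    gives the left-hand side plus the right-hand side. *)
Lemma br_exchange x y z d :
  {[x ** y ** z, d]} + {[z, x ** y ** d]} =
  {[y ** z, x ** d]} + {[x ** z, y ** d]}.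
Proof.
have main : x ** y ** {[z, d]} + x ** y ** {[z, d]} +
    (x ** y ** {[z, d]} + x ** y ** {[z, d]}) =
    {[x ** y ** z, d]} + {[z, x ** y ** d]} +
    ({[y ** z, x ** d]} + {[x ** z, y ** d]}).
  rewrite -!(tp_mulA tpP) -linearDr mul_br_double linearDr addrACA.
  rewrite !mul_br_double.
  by rewrite [X in _ + X]addrC addrACA; congr (_ + _); rewrite addrC.
by move: main; rewrite mul_br_double => /addrI.
Qed.

(** This is br_exchange for the triple x, c, y, rearranged so that both sides
    have the same shape and differ by the exchange of y and z. *)
Lemma br_exchange_swap x y z c :
  {[x ** y, z ** c]} + {[z, x ** y ** c]} =
  {[z ** x, y ** c]} + {[y, z ** x ** c]}.
Proof.
have := br_exchange x c y z.
rewrite [br (x ** c ** y) z]brC [br (c ** y) _]brC.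
rewrite [x ** c ** y]tp_mulAC [x ** c ** z]tp_mulAC.
rewrite ![c ** _](tp_mulC tpP) [x ** z](tp_mulC tpP).
move/(congr1 (+%R {[z ** x, y ** c]})); rewrite !addrA subrr add0r => <-.
by rewrite addrAC subrK.
Qed.

(** Even part of the Jordan identity at x, y, z^s, applied to d^s. *)
Lemma jordan_even_even_odd x y z d :
  x ** y ** {[z, d]} - {[z, x ** y ** d]}
  + ({[y ** z, x ** d]} - x ** {[y ** z, d]})
  + ({[z ** x, y ** d]} - y ** {[z ** x, d]}) = 0.
Proof.
have sum_q_r : x ** {[y ** z, d]} + y ** {[z ** x, d]} =
    {[x ** y ** z, d]} + x ** y ** {[z, d]}.
  apply: double_inj; rewrite [LHS]addrACA [RHS]addrACA !mul_br_double.
  rewrite [z ** x](tp_mulC tpP) !(tp_mulA tpP) [y ** x](tp_mulC tpP).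
  by rewrite addrACA -br_exchange.
rewrite [X in X + _ = _]addrACA -opprD addrACA -opprD.
apply/eqP; rewrite subr_eq0; apply/eqP.
rewrite -!addrA [z ** x](tp_mulC tpP) -br_exchange -[x ** z](tp_mulC tpP).
rewrite sum_q_r addrC -!addrA addrCA; congr (_ + _).
Qed.

(** Odd part of the Jordan identity at x, y^s, z^s, applied to d^s. *)
Lemma jordan_even_odd_odd x y z d :
  x ** y ** {[z, d]} + z ** {[x ** y, d]} =
  z ** x ** {[y, d]} + y ** {[z ** x, d]}.
Proof.
apply: double_inj; rewrite [LHS]addrACA [RHS]addrACA !mul_br_double.
rewrite [y ** (z ** x)](tp_mulC tpP) -[z ** x ** y](tp_mulA tpP).
rewrite [z ** (x ** y)](tp_mulC tpP) [LHS]addrACA [RHS]addrACA.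
congr (_ + _).
by rewrite addrC br_exchange_swap addrC.
Qed.

(** Let B be this sum and A the sum of the {d o z, {x, y}}. Multiplying the Jacobi
    identity by 2d gives A + B = 0. Expanding each 2 d o {x, y} inside B and
    collecting with the Jacobi identities for the triples in which one of x, y,
    z is multiplied by d gives 2B = - A. Hence B = 0. *)
Lemma br_mul_br_cyclic x y z d :
  {[z, d ** {[x, y]}]} + {[x, d ** {[y, z]}]} + {[y, d ** {[z, x]}]} = 0.
Proof.
set B := LHS.
pose A := {[d ** z, {[x, y]}]} + {[d ** x, {[y, z]}]} + {[d ** y, {[z, x]}]}.
have jac := lie_jacobi (tp_lie tpP).
have AB : A + B = 0.
  rewrite addrACA [X in X + _ = _]addrACA -!mul_br_double.
  rewrite -!(linearDr mul d) [X in mul d (X + _)]addrACA.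
  rewrite [X in mul d X]addrACA linearDr.
  by rewrite jac linear0r addr0.
have BB : B + B = - A.
  have leibniz u v w :
    {[w, d ** {[u, v]}]} + {[w, d ** {[u, v]}]} =
    {[w, {[d ** u, v]}]} + {[w, {[u, d ** v]}]}.
    by rewrite -linearDr mul_br_double linearDr.
  rewrite [LHS]addrACA [X in X + _ = _]addrACA !leibniz.
  (* The six terms of 2B and the three of A regroup into these identities. *)
  have jx := jac (d ** x) y z.
  have jy := jac (d ** y) z x.
  have jz := jac (d ** z) x y.
  apply/eqP; rewrite -addr_eq0.
  rewrite [X in X == _](AC (2*2*2*3) (8*6*1*(9*2*3)*(7*4*5))).
  by rewrite /= jx jy jz !addr0.
have NA : - A = B by apply/eqP; rewrite eq_sym -addr_eq0 addrC AB.
by apply: (addrI B); rewrite addr0 BB.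
Qed.

(** Expanding the double of {x, y} o {z, d} yields {z o {x, y}, d} and
    {z, d o {x, y}}; the cyclic sums of both vanish. *)
Lemma mul_br_br_cyclic x y z d :
  {[x, y]} ** {[z, d]} + {[y, z]} ** {[x, d]} + {[z, x]} ** {[y, d]} = 0.
Proof.
apply: double_inj; rewrite addr0 addrACA [X in X + _ = _]addrACA.
rewrite !mul_br_double [X in X + _ = _]addrACA [LHS]addrACA.
rewrite ![{[_, _]} ** _](tp_mulC tpP) br_mul_br_cyclic addr0.
have := congr1 (br^~ d) (mul_br_cyclic z x y).
by rewrite !linearDl linear0l.
Qed.

(** Odd-odd-odd case of the Jordan identity, applied to d^s. *)
Lemma jordan_odd_odd_odd x y z d :
  {[x, y]} ** {[z, d]} - {[z, {[x, y]} ** d]}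
  + ({[y, z]} ** {[x, d]} - {[x, {[y, z]} ** d]})
  + ({[z, x]} ** {[y, d]} - {[y, {[z, x]} ** d]}) = 0.
Proof.
rewrite [X in X + _ = _]addrACA -opprD addrACA -opprD mul_br_br_cyclic.
by rewrite ![_ ** d](tp_mulC tpP) br_mul_br_cyclic subrr.
Qed.

(** * The Kantor double is a Jordan superalgebra *)

Local Notation J := (kantor_double P).
Local Notation "u *s v" := (kantor_mul mul br u v)
  (at level 40, left associativity).

Lemma kantor_mul_even a c d : (a, 0) *s (c, d) = (a ** c, a ** d) :> J.
Proof. by rewrite /kantor_mul /= !linear0l addr0 add0r. Qed.

Lemma kantor_mul_odd b c d : (0, b) *s (c, d) = ({[b, d]}, b ** c) :> J.
Proof. by rewrite /kantor_mul /= !linear0l addr0 add0r. Qed.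

Lemma kantor_part_subspace i : is_subspace (kantor_part P i).
Proof.
by apply/subspaceP; case: i; split=> //= k u v -> ->; rewrite scaler0 addr0.
Qed.

Lemma kantor_superalgebra :
  is_superalgebra (kantor_part P) (kantor_mul mul br).
Proof.
split.
- exact: kantor_part_subspace.
- move=> [a b]; exists (a, 0), (0, b); split=> //.
  by congr pair; rewrite /= ?addr0 ?add0r.
- apply/seteqP; split=> [[a b] [/= -> ->]|_ ->] //.
- move=> [] [] [a b] [c d] /= -> -> ; rewrite /kantor_mul /=.
  all: by rewrite ?linear0l ?linear0r ?addr0 //.
Qed.

Lemma kantor_supercomm i j x y : kantor_part P i x -> kantor_part P j y ->
  x *s y = supersign F i j *: (y *s x).
Proof.
case: x y => [a b] [c d]; rewrite /supersign.
case: i j => [] [] /= -> ->; rewrite ?kantor_mul_even ?kantor_mul_odd /=.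
- by rewrite expr1 scaleN1r brC !linear0r; congr pair; rewrite oppr0.
- by rewrite expr0 scale1r linear0r (tp_mulC tpP) linear0r.
- by rewrite expr0 scale1r !linear0r (tp_mulC tpP).
- by rewrite expr0 scale1r !linear0r (tp_mulC tpP).
Qed.

Local Notation L := (kantor_mul mul br).

Definition jordan_defect (i j k : bool) (x y z v : J) : J :=
    supersign F i k *: supercomm (i (+) j) k (L (x *s y)) (L z) v
  + supersign F j i *: supercomm (j (+) k) i (L (y *s z)) (L x) v
  + supersign F k j *: supercomm (k (+) i) j (L (z *s x)) (L y) v.

(** Rotating the arguments permutes the three terms, signs included; so the
    parities can be assumed to be in nondecreasing order. *)
Lemma jordan_defect_rot i j k x y z v :
  jordan_defect i j k x y z v = jordan_defect j k i y z x v.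
Proof. by rewrite /jordan_defect addrC addrA addrC addrA. Qed.

Lemma kantor_jordan_sorted (i j k : bool) x x' y y' z z' :
  (i <= j <= k)%N ->
  kantor_part P i (x, x') -> kantor_part P j (y, y') ->
  kantor_part P k (z, z') ->
  forall v, jordan_defect i j k (x, x') (y, y') (z, z') v = 0.
Proof.
case: i j k => [] [] [] //= _ -> -> -> [c d].
all: rewrite /jordan_defect /supercomm /supersign /=.
all: rewrite ?expr0 ?expr1 ?scale1r ?scaleN1r ?opprK.
all: rewrite /kantor_mul /= !(linear0l, linear0r, add0r, addr0).
all: apply: injective_projections; rewrite /=.
- by rewrite -!opprD jordan_odd_odd_odd oppr0.
- by rewrite ![{[_, _]} ** (_ ** _)]tp_mulCA !subrr oppr0 !addr0.
- by rewrite [x ** (_ ** _)]tp_mulCA subrr addr0 br_exchange_swap subrr.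
- by rewrite [x ** (_ ** _)]tp_mulCA subrr addr0 jordan_even_odd_odd subrr.
- by rewrite jordan_even_even_odd.
- rewrite [x ** y ** _]tp_mulCA [y ** z' ** _]tp_mulCA [z' ** x ** _]tp_mulCA.
  by rewrite !subrr !addr0.
- rewrite [x ** y ** _]tp_mulCA [y ** z ** _]tp_mulCA [z ** x ** _]tp_mulCA.
  by rewrite !subrr !addr0.
- rewrite [x ** y ** _]tp_mulCA [y ** z ** _]tp_mulCA [z ** x ** _]tp_mulCA.
  by rewrite !subrr !addr0.
Qed.

Lemma kantor_jordan i j k x y z :
  kantor_part P i x -> kantor_part P j y -> kantor_part P k z ->
  forall v, jordan_defect i j k x y z v = 0.
Proof.
case: x y z => [x x'] [y y'] [z z'] Gx Gy Gz v.
have [ijk|] := boolP (i <= j <= k)%N.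
  exact: kantor_jordan_sorted.
have [jki|] := boolP (j <= k <= i)%N.
  by move=> _; rewrite jordan_defect_rot; apply: kantor_jordan_sorted.
move=> njki nijk; rewrite 2!jordan_defect_rot; apply: kantor_jordan_sorted => //.
by case: i j k njki nijk {Gx Gy Gz} => [] [] [].
Qed.

(** * Simplicity *)

Lemma tp_simple_dichotomy (I : set P) : tp_simple mul br -> is_subspace I ->
  (forall x y, I x -> I (x ** y)) -> (forall x y, I x -> I {[x, y]}) ->
  I = [set 0] \/ I = setT.
Proof.
move=> simpleP Isub Imul Ibr; apply: contrapT => /not_orP[I0 IT].
by apply: simpleP; exists I.
Qed.

(** The span of the brackets is an ideal: half of the compatibility axiom writes
    x o {a, b} as a combination of brackets. *)
Lemma bracket_span_full : tp_simple mul br -> (exists x y, {[x, y]} <> 0) ->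
  linear_span [set {[a, b]} | a in setT & b in setT] = setT.
Proof.
move=> simpleP [x0 [y0 br_neq0]]; set D := linear_span _.
have Dsub : is_subspace D by exact: span_subspace.
have Dbr a b : D {[a, b]} by apply: mem_span; exists a => //; exists b.
have [||D0|//] := tp_simple_dichotomy D simpleP Dsub.
- move=> x y; apply: (span_sub _ [set u | D (u ** y)]).
    exact: subspace_preiml.
  move=> _ [a _ [b _ <-]] /=.
  rewrite -[_ ** _](scalerK two_neq0) (tp_mulC tpP) (tp_compat tpP).
  by apply: subspaceZ => //; apply: subspaceD.
- by move=> x y _; apply: Dbr.
- by case: br_neq0; have := Dbr x0 y0; rewrite D0.
Qed.

(** I0 and I1 are the even and odd parts of a graded ideal of the double. *)
Section GradedParts.
Variables (I0 I1 : set P).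
Hypotheses (I1sub : is_subspace I1)
  (I0_mul : forall x a, I0 a -> I1 (x ** a))
  (I1_mul : forall x b, I1 b -> I1 (x ** b))
  (I1_br : forall x b, I1 b -> I0 {[x, b]}).

Definition multiplier : set P := [set r | forall x, I1 (x ** r)].

Lemma multiplier_subspace : is_subspace multiplier.
Proof.
apply/subspaceP; split=> [x|c u v Ru Rv x].
  by rewrite linear0r; apply: subspace0.
by rewrite linearPr; apply: subspaceD => //; apply: subspaceZ.
Qed.

Lemma multiplier_mul r y : multiplier r -> multiplier (r ** y).
Proof. by move=> Rr x; rewrite [r ** y](tp_mulC tpP) (tp_mulA tpP). Qed.

(** Since P o P = P, it suffices to test multiplication by x o w. The identity
    writes x o w o {e, y} as a sum of three terms of I1: x o e is in I1, hence
    {x o e, y} is in I0, and the other two terms are multiples of e. *)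
Lemma multiplier_br e y :
  product_span mul = setT -> multiplier e -> multiplier {[e, y]}.
Proof.
move=> PP Re z; have : product_span mul z by rewrite PP.
apply: (span_sub _ [set u | I1 (u ** {[e, y]})]); first exact: subspace_preiml.
move=> _ [x _ [w _ <-]] /=.
have -> : x ** w ** {[e, y]} =
   w ** {[x ** e, y]} - e ** {[x ** y, w]} + e ** (x ** {[y, w]}).
  apply: (addrI (x ** w ** {[e, y]})).
  rewrite -(tp_mulA tpP) tp_mulCA -linearDr mul_br_double linearDr.
  have cyc1 := mul_br_cyclic w e (x ** y).
  have cyc2 := congr1 (mul x) (mul_br_cyclic y w e).
  rewrite !linearDr linear0r (tp_mulA tpP x y) in cyc2.
  rewrite [x ** (w ** _)]tp_mulCA [x ** (e ** _)]tp_mulCA -addrA in cyc2.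
  have ab := addrI _ (etrans (etrans (addrC _ _) cyc1) (esym cyc2)).
  by rewrite [RHS](AC (1*3) (2*(1*4)*3)) /= -ab addrA addrK.
apply: subspaceD => //; last by rewrite (tp_mulC tpP).
apply: subspaceB => //; last by rewrite (tp_mulC tpP).
by apply: I0_mul; rewrite brC -linearNl; apply: I1_br.
Qed.

Lemma graded_parts_trivial : tp_simple mul br -> product_span mul = setT ->
  (exists x y, {[x, y]} <> 0) -> is_subspace I0 ->
  (I0 = [set 0] /\ I1 = [set 0]) \/ (I0 = setT /\ I1 = setT).
Proof.
move=> simpleP PP br_neq0 I0sub.
have I0R : I0 `<=` multiplier by move=> a Ia x; apply: I0_mul.
have I1R : I1 `<=` multiplier by move=> b Ib x; apply: I1_mul.
have [||R0|RT] := tp_simple_dichotomy multiplier simpleP multiplier_subspace.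
- by move=> x y; apply: multiplier_mul.
- by move=> x y; apply: multiplier_br.
- left; rewrite R0 in I0R I1R.
  by split; apply/seteqP; split=> // _ ->; apply: subspace0.
- right.
  have I1T : I1 = setT.
    rewrite -subTset -PP; apply: span_sub => // _ [x _ [y _ <-]].
    by have : multiplier y by rewrite RT.
  split=> //; rewrite -subTset -bracket_span_full //.
  by apply: span_sub => // _ [x _ [y _ <-]]; apply: I1_br; rewrite I1T.
Qed.
End GradedParts.

Lemma graded_ideal_trivial (K : set J) :
  tp_simple mul br -> product_span mul = setT ->
  (exists x y, {[x, y]} <> 0) ->
  is_graded_ideal (kantor_part P) (kantor_mul mul br) K ->
  K = [set 0] \/ K = setT.
Proof.
move=> simpleP PP br_neq0 [Ksub Kl _ Kgr].
pose I0 : set P := [set a | K (a, 0)].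
pose I1 : set P := [set b | K (0, b)].
have KE u : K u <-> I0 u.1 /\ I1 u.2.
  case: u => [a b]; split=> [/Kgr [[a0 b0] [[a1 b1]]]|[/= Ka Kb]] /=.
    move=> [[/= b00 Ka] [/= a10 Kb] [-> ->]]; move: Ka Kb.
    by rewrite b00 a10 /I0 /I1 /= addr0 add0r.
  have -> : (a, b) = (a, 0) + (0, b) :> J.
    by congr pair; rewrite /= ?addr0 ?add0r.
  exact: subspaceD.
have [I0sub I1sub] : is_subspace I0 /\ is_subspace I1.
  have [K0 Klin] := (subspaceP K).1 Ksub.
  split; apply/subspaceP; split=> //= k u v Ku Kv.
    by have := Klin k _ _ Ku Kv; rewrite /I0 /=; congr K;
      congr pair; rewrite /= scaler0 addr0.
  by have := Klin k _ _ Ku Kv; rewrite /I1 /=; congr K;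
    congr pair; rewrite /= scaler0 addr0.
have [|||[K0 K1]|[K0 K1]] // :=
  graded_parts_trivial I0 I1 I1sub _ _ _ simpleP PP br_neq0 I0sub.
- move=> x a /(Kl (0, x)); rewrite /I1 /=; congr K.
  by rewrite /kantor_mul /= !(linear0l, linear0r, add0r, addr0).
- move=> x a /(Kl (x, 0)); rewrite /I1 /=; congr K.
  by rewrite /kantor_mul /= !(linear0l, linear0r, add0r, addr0).
- move=> x a /(Kl (0, x)); rewrite /I1 /=; congr K.
  by rewrite /kantor_mul /= !(linear0l, linear0r, add0r, addr0).
- left; apply/seteqP; split=> [[a b] /KE|_ ->]; last exact: subspace0.
  by rewrite K0 K1 => -[/= -> ->].
- by right; rewrite -subTset => u _; apply/KE; rewrite K0 K1.
Qed.

(** An ideal I of P gives the graded ideal I + I^s. *)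
Lemma kantor_simple_tp_simple :
  sa_simple (kantor_part P) (kantor_mul mul br) -> tp_simple mul br.
Proof.
move=> simpleJ [I [Isub I0 IT Imul Ibr]]; apply: simpleJ.
have ImulC x y : I y -> I (x ** y) by rewrite (tp_mulC tpP); apply: Imul.
have IbrC x y : I y -> I {[x, y]}.
  by move=> Iy; rewrite brC; apply: subspaceN => //; apply: Ibr.
exists [set u | I u.1 /\ I u.2]; split; first split.
- apply/subspaceP; split=> [|k u v [? ?] [? ?]]; first by split; apply: subspace0.
  by split; apply: subspaceD => //; apply: subspaceZ.
- by move=> x y [? ?]; split=> /=; apply: subspaceD; auto.
- by move=> x y [? ?]; split=> /=; apply: subspaceD; auto.
- move=> [a b] [/= Ia Ib]; exists (a, 0), (0, b); split; rewrite /=.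
  + by split=> //; split=> //; apply: subspace0.
  + by split=> //; split=> //; apply: subspace0.
  + by congr pair; rewrite /= ?addr0 ?add0r.
- move=> E; apply: I0; apply/seteqP; split=> [a Ia|_ ->]; last exact: subspace0.
  have : [set u : J | I u.1 /\ I u.2] (a, 0) by split=> //; apply: subspace0.
  by rewrite E => -[].
- move=> E; apply: IT; rewrite -subTset => a _.
  have : [set u : J | I u.1 /\ I u.2] (a, 0) by rewrite E.
  by case.
Qed.

(** The graded ideal P + (P o P)^s is nonzero because P is, and it is proper as
    soon as P o P is. *)
Lemma kantor_simple_product_full : (exists x y, {[x, y]} <> 0) ->
  sa_simple (kantor_part P) (kantor_mul mul br) -> product_span mul = setT.
Proof.
move=> [x0 [y0 br_neq0]] simpleJ; apply: contrapT => PPnT; apply: simpleJ.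
pose S := product_span mul.
have Ssub : is_subspace S by exact: span_subspace.
have Smul a b : S (a ** b).
  by apply: mem_span; exists a => //; exists b.
exists [set u | S u.2]; split; first split.
- apply/subspaceP; split=> [|k u v ? ?]; first exact: (subspace0 S).
  by apply: (subspaceD S) => //; apply: (subspaceZ S).
- by move=> x y _; apply: (subspaceD S).
- by move=> x y _; apply: (subspaceD S).
- move=> [a b] /= Sb; exists (a, 0), (0, b); split=> //.
  + by split=> //; apply: (subspace0 S).
  + by congr pair; rewrite /= ?addr0 ?add0r.
- move=> E; apply: br_neq0.
  have : [set u : J | S u.2] ({[x0, y0]}, 0) by exact: (subspace0 S).
  by rewrite E => -[].
- move=> E; apply: PPnT; rewrite -subTset => b _.
  suff : [set u : J | S u.2] (0, b) by [].
  by rewrite E.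
Qed.

End Identities.

Theorem mainTheorem2 (F : fieldType) (P : lmodType F)
    (mul br : {bilinear P -> P -> P})
    (char_neq2 : 2%N \notin [pchar F])
    (tpP : is_transposed_poisson mul br) :
  is_jordan_superalgebra (kantor_part P) (kantor_mul mul br)
  /\ ((exists x y, br x y <> 0) ->
      (sa_simple (kantor_part P) (kantor_mul mul br) <->
       tp_simple mul br /\ product_span mul = setT)).
Proof.
split.
  split; first exact: kantor_superalgebra.
    by move=> i j x y; apply: kantor_supercomm.
  by move=> i j k x y z; apply: kantor_jordan.
move=> br_neq0; split=> [simpleJ|[simpleP PP] [K [Kideal K0 KT]]].
  split; first exact: kantor_simple_tp_simple tpP simpleJ.
  exact: kantor_simple_product_full br_neq0 simpleJ.
by case: (graded_ideal_trivial char_neq2 tpP K simpleP PP br_neq0 Kideal).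
Qed.
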